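(* Let $k\ge 1$ and $n_0\ge 0$ be integers, let $\lambda_{(n)_i}>0$ ($n\ge n_0$, $1\le i\le k$) be the jump rates of a generalized birth process $\{\mathcal{X}(t)\}_{t\ge 0}$ started at $n_0$, and let $p(n,t)=\mathrm{Pr}\{\mathcal{X}(t)=n\}$. If $$\sum_{m=n_0}^{\infty}\left(\sum_{i=1}^{k}\sum_{j=1}^{i}\lambda_{(m-j+1)_i}^{2}\right)^{-1/2}=\infty,$$ then $\sum_{m=n_0}^{\infty}p(m,t)=1$ for all $t\ge 0$.
   Context: The generalized birth process (GBP) $\{\mathcal{X}(t)\}_{t\ge0}$ has $\mathrm{Pr}\{\mathcal{X}(0)=n_0\}=1$ and performs jumps of size $1,2,\dots,k$ with positive rates $\lambda_{(n)_1},\dots,\lambda_{(n)_k}$ when in state $n$: as $h\to0$, $$\mathrm{Pr}\{\mathcal{X}(t+h)=n+i\mid \mathcal{X}(t)=n\}=\begin{cases}1-\sum_{i=1}^{k}\lambda_{(n)_i}h+o(h), & i=0,\\ \lambda_{(n)_i}h+o(h), & i=1,\dots,k,\\ o(h), & i>k.\end{cases}$$ Its state probabilities $p(n,t)=\mathrm{Pr}\{\mathcal{X}(t)=n\}$ satisfy $$\frac{\mathrm{d}}{\mathrm{d}t}p(n,t)=-\sum_{i=1}^{k}\lambda_{(n)_i}p(n,t)+\sum_{i=1}^{\min\{n,k\}}\lambda_{(n-i)_i}p(n-i,t),\quad n\ge n_0,$$ with $p(n_0,0)=1$ and $p(n,0)=0$ for $n>n_0$; here $p(n,t)=0$ for all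 $n<n_0$. Convention: $\lambda_{(n)_i}=0$ for $n<n_0$ (this affects only finitely many terms of the series in the hypothesis, and not its divergence). *)

(* Defs.v *)
From HB Require Import structures.
From mathcomp Require Export all_boot all_order all_algebra.
From mathcomp Require Export all_classical all_reals all_analysis.
Export Order.TTheory GRing.Theory Num.Theory.
Export numFieldNormedType.Exports.

Set Implicit Arguments.
Unset Strict Implicit.
Unset Printing Implicit Defensive.

Local Open Scope classical_set_scope.
Local Open Scope ring_scope.

(* Rates extended by 0 below n0.  The state is an integer because m - j + 1
   may be negative, where truncated subtraction would wrongly give state 0. *)
Definition rate (R : realType) (n0 : nat) (lam : nat -> nat -> R)
    (n : int) (i : nat) : R :=
  if n0%:Z <= n then lam `|n|%N i else 0.

Section GeneralizedBirthProcess.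
Context (R : realType) (d : measure_display) (T : measurableType d).
Variable P : probability T R.

Definition cond_prob (A B : set T) : R := fine (P (A `&` B)) / fine (P B).

(* The process may make infinitely many jumps in finite time: X t w = None
   means that the path w has exploded by time t, so that the p(n,t) need not
   sum to 1.  Only times t >= 0 are relevant. *)
Definition at_state (X : R -> T -> option nat) (n : nat) (t : R) : set T :=
  [set w | X t w = Some n].

Definition state_prob (X : R -> T -> option nat) (n : nat) (t : R) : R :=
  fine (P (at_state X n t)).

(* The limits h -> 0 are from the right, and the conditional probabilities are
   constrained only where the conditioning event has positive probability.
   The forward equation does not follow from gbp_stay, gbp_jump and gbp_far
   (their o(h) terms depend on t, so they allow, e.g., all the mass to explode
   at a fixed time).  It is two-sided, for t > 0; at t = 0 its one-sided
   version is contained in gbp_init, gbp_stay, gbp_jump and gbp_far. *)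
Record generalized_birth_process (k n0 : nat) (lam : nat -> nat -> R)
    (X : R -> T -> option nat) : Prop := {
  gbp_measurable : forall (t : R) (A : set (option nat)), 0 <= t ->
    measurable (X t @^-1` A);
  gbp_init : P (at_state X n0 0) = 1%E;
  gbp_below : forall (n : nat) (t : R), (n < n0)%N -> 0 <= t ->
    state_prob X n t = 0;
  gbp_stay : forall (n : nat) (t : R), (n0 <= n)%N -> 0 <= t ->
    0 < state_prob X n t ->
    (fun h => cond_prob (at_state X n (t + h)) (at_state X n t)
              - (1 - (\sum_(1 <= i < k.+1) lam n i) * h))
      =o_ (0^'+) id;
  gbp_jump : forall (n i : nat) (t : R), (n0 <= n)%N -> (1 <= i <= k)%N ->
    0 <= t -> 0 < state_prob X n t ->
    (fun h => cond_prob (at_state X (n + i) (t + h)) (at_state X n t)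
              - lam n i * h)
      =o_ (0^'+) id;
  gbp_far : forall (n i : nat) (t : R), (n0 <= n)%N -> (k < i)%N ->
    0 <= t -> 0 < state_prob X n t ->
    (fun h => cond_prob (at_state X (n + i) (t + h)) (at_state X n t))
      =o_ (0^'+) id;
  gbp_forward : forall (n : nat) (t : R), (n0 <= n)%N -> 0 < t ->
    is_derive t 1 (state_prob X n)
      (- (\sum_(1 <= i < k.+1) rate n0 lam n%:Z i) * state_prob X n t
       + \sum_(1 <= i < (minn n k).+1)
           rate n0 lam (n%:Z - i%:Z) i * state_prob X (n - i)%N t)
}.

End GeneralizedBirthProcess.

(* Main.v *)
Require Import Defs.
From mathcomp Require Import lra zify.

Local Open Scope classical_set_scope.
Local Open Scope ring_scope.

(** The idea is to weigh the conservation law at every level m by the m-th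
    term of the divergent series.  Let S_m(t) be the sum of p(n,t) over n <= m.
    Summing the forward equations, everything cancels except the jumps from a
    state n <= m to a state n + i > m ([net_flow]), so that
      S_m' = - sum over n <= m < n + i of lambda_{(n)_i} p(n,t).
    Let a_m be the m-th term of the series of the hypothesis.  The rates in
    this flow are exactly those whose squares are summed in a_m^{-2}, hence
    a_m lambda_{(n)_i} <= 1 ([powRVhalf_le]).  A jump of size i from n crosses
    just i levels, so summing over m gives
      sum_{m < M} a_m S_m' >= - sum_n p(n,t) (1 + ... + k) >= - C
    with C = 1 + ... + k, uniformly in M ([sum_levels_le]).

    As S_m(0+) = 1, the mean value theorem turns this into
      sum_{m < M} a_m (1 - S_m(t)) <= C t
    ([weighted_deficit_le]).  If the total mass at time t were 1 - delta with
    delta > 0, then 1 - S_m(t) >= delta for all m, and the partial sums of the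
    a_m would be bounded by C t / delta, contradicting divergence. *)

(** * Flow across levels *)

Lemma sum_shift (V : zmodType) (n0 m i : nat) (f : nat -> V) :
  (forall n, (n < n0)%N -> f n = 0) ->
  \sum_(n0 <= n < m | (i <= n)%N) f (n - i)%N =
  \sum_(n0 <= n < m | (n + i < m)%N) f n.
Proof.
move=> f0.
have from0 (P : pred nat) (g : nat -> V) : (forall n, (n < n0)%N -> g n = 0) ->
    \sum_(n0 <= n < m | P n) g n = \sum_(0 <= n < m | P n) g n.
  move=> g0; rewrite (big_nat_widenl n0 0)//= [RHS]big_mkcond [LHS]big_mkcond.
  apply: eq_bigr => n _; case: (leqP n0 n) => nn0; rewrite ?andbT ?andbF//.
  by rewrite g0// if_same.
(* below n0 both sides vanish, so the sums may start at 0, where the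
   change of variables is a plain shift *)
rewrite !from0 // => [|n nn0]; last by rewrite f0// (leq_ltn_trans _ nn0)// leq_subr.
transitivity (\sum_(i <= n < m) f (n - i)%N).
  by rewrite [RHS](big_nat_widenl i 0).
rewrite -{1}[i]add0n big_addn.
rewrite (big_nat_widen 0 (m - i) m) ?leq_subr//.
by apply: eq_big => n //=; rewrite ?addnK// ltn_subRL addnC.
Qed.

(** Conservation of mass below level m, with q n i the flow from n to n + i:
    the inflow into states below m comes from jumps that stay below m, which
    cancels that part of the outflow. *)
Lemma net_flow (V : zmodType) (k n0 m : nat) (q : nat -> nat -> V) :
  (forall n i, (n < n0)%N -> q n i = 0) ->
  \sum_(n0 <= n < m) (- (\sum_(1 <= i < k.+1) q n i)
     + \sum_(1 <= i < (minn n k).+1) q (n - i)%N i) =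
  - \sum_(n0 <= n < m) \sum_(1 <= i < k.+1 | (m <= n + i)%N) q n i.
Proof.
move=> q0; rewrite big_split /= sumrN.
have -> : \sum_(n0 <= n < m) \sum_(1 <= i < (minn n k).+1) q (n - i)%N i =
    \sum_(n0 <= n < m) \sum_(1 <= i < k.+1 | (n + i < m)%N) q n i.
  transitivity (\sum_(n0 <= n < m) \sum_(1 <= i < k.+1 | (i <= n)%N) q (n - i)%N i).
    apply: eq_bigr => n _; rewrite (big_nat_widen _ _ k.+1) ?ltnS ?geq_minr//.
    rewrite big_nat_cond [RHS]big_nat_cond; apply: eq_bigl => i.
    by lia.
  rewrite (exchange_big_dep_nat xpredT)//= [RHS](exchange_big_dep_nat xpredT)//=.
  by apply: eq_bigr => i _; apply: sum_shift => n; apply: q0.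
rewrite -!sumrN -big_split/=; apply: eq_bigr => n _.
rewrite (bigID (fun i => (m <= n + i)%N))/= opprD -addrA.
rewrite (eq_bigl (fun i => (n + i < m)%N) _ (fun i => esym (ltnNge _ _))).
by rewrite addNr addr0.
Qed.

Lemma sum_window_le (R : numDomainType) (a b n i : nat) (x : R) : 0 <= x ->
  \sum_(a <= m < b | (n <= m < n + i)%N) x <= i%:R * x.
Proof.
move=> x0; rewrite big_const_seq iter_addr_0 -[x *+ _]mulr_natl ler_wpM2r// ler_nat.
rewrite -size_filter -[leqRHS](size_iota n); apply: uniq_leq_size.
  by rewrite filter_uniq// iota_uniq.
by move=> m; rewrite mem_filter mem_iota => /andP[].
Qed.

(** The flow from n by jumps of size i is counted at the levels
    m = n, ..., n + i - 1 only, that is at most i times. *)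
Lemma sum_levels_le (R : numDomainType) (k n0 M : nat) (p : nat -> R) :
  (forall n, 0 <= p n) ->
  \sum_(n0 <= n < M) p n <= 1 ->
  \sum_(n0 <= m < M) \sum_(n0 <= n < m.+1)
     \sum_(1 <= i < k.+1 | (m < n + i)%N) p n <= \sum_(1 <= i < k.+1) i%:R.
Proof.
move=> p0 p1.
have -> : \sum_(n0 <= m < M) \sum_(n0 <= n < m.+1)
     \sum_(1 <= i < k.+1 | (m < n + i)%N) p n =
   \sum_(n0 <= n < M) \sum_(1 <= i < k.+1)
     \sum_(n0 <= m < M | (n <= m < n + i)%N) p n.
  transitivity (\sum_(n0 <= m < M) \sum_(n0 <= n < M | (n <= m)%N)
     \sum_(1 <= i < k.+1 | (m < n + i)%N) p n).
    apply: eq_big_nat => m /andP[_ mM].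
    by rewrite (big_nat_widen _ _ M).
  rewrite (exchange_big_dep_nat xpredT)//=; apply: eq_bigr => n _.
  by rewrite (exchange_big_dep_nat xpredT).
apply: (@le_trans _ _ (\sum_(n0 <= n < M) \sum_(1 <= i < k.+1) i%:R * p n)).
  by apply: ler_sum => n _; apply: ler_sum => i _; exact: sum_window_le.
rewrite (eq_bigr (fun n => (\sum_(1 <= i < k.+1) i%:R) * p n)); last first.
  by move=> n _; rewrite mulr_suml.
by rewrite -mulr_sumr ler_piMr// sumr_ge0.
Qed.

(** * Analytic estimates *)

Lemma is_derive_sum_seq (R : realType) (I : eqType) (s : seq I)
    (f : I -> R -> R) (df : I -> R) (t : R) :
  (forall i, i \in s -> is_derive t 1 (f i) (df i)) ->
  is_derive t 1 (fun x => \sum_(i <- s) f i x) (\sum_(i <- s) df i).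
Proof.
elim: s => [_|i s IH H].
  rewrite big_nil (_ : (fun _ => _) = cst 0) ?funeqE => [|x].
    exact: is_derive_cst.
  by rewrite big_nil.
rewrite big_cons (_ : (fun _ => _) = f i + (fun x => \sum_(i <- s) f i x)).
  apply: is_deriveD; first exact/H/mem_head.
  by apply: IH => j js; apply: H; rewrite inE js orbT.
by apply/funext => x; rewrite big_cons.
Qed.

Lemma powRVhalf_le (R : realType) (l Q : R) : 0 < l -> l ^+ 2 <= Q ->
  Q `^ (- 2^-1) * l <= 1.
Proof.
move=> l0 lQ.
have Q0 : 0 < Q by rewrite (lt_le_trans _ lQ)// exprn_gt0.
rewrite powRN powR12_sqrt ?(ltW Q0)// ler_pdivrMl ?sqrtr_gt0// mulr1.
by rewrite -[l]gtr0_norm// -sqrtr_sqr ler_sqrt// ltW.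
Qed.

(** The forward equations bound the a-weighted sum of the masses lost above
    each level.  The forward equations are given for positive times only, so
    the estimate is made on [h, t] and then h tends to 0 from the right.  The
    initial mass enters through p n0 h, which is at most S_m at time h for
    every level m. *)
Lemma weighted_deficit_le (R : realType) (k n0 M : nat) (r : nat -> nat -> R)
    (p : nat -> R -> R) (a : nat -> R) (t : R) :
  (forall n i, (n < n0)%N -> r n i = 0) ->
  (forall n (s : R), 0 <= p n s) ->
  (forall N (s : R), 0 <= s -> \sum_(n0 <= n < N) p n s <= 1) ->
  p n0 h @[h --> 0^'+] --> (1 : R) ->
  (forall n (s : R), (n0 <= n)%N -> 0 < s ->
    is_derive s 1 (p n) (- (\sum_(1 <= i < k.+1) r n i * p n s)
      + \sum_(1 <= i < (minn n k).+1) r (n - i)%N i * p (n - i)%N s)) ->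
  (forall m, (n0 <= m)%N -> 0 <= a m) ->
  (forall m n i, (n0 <= n <= m)%N -> (m < n + i)%N -> (1 <= i <= k)%N ->
    a m * r n i <= 1) ->
  0 < t ->
  \sum_(n0 <= m < M) a m * (1 - \sum_(n0 <= n < m.+1) p n t) <=
  (\sum_(1 <= i < k.+1) i%:R) * t.
Proof.
move=> r0 p0 p1 init fwd a0 ar t0; set C := \sum_(_ <= i < _) _.
pose S m s := \sum_(n0 <= n < m.+1) p n s.
pose Phi s := \sum_(n0 <= m < M) a m * S m s.
pose dS m s := - \sum_(n0 <= n < m.+1)
   \sum_(1 <= i < k.+1 | (m < n + i)%N) r n i * p n s.
have dS_ m (s : R) : 0 < s -> is_derive s 1 (S m) (dS m s).
  move=> s0; rewrite /dS -(@net_flow _ k n0 m.+1 (fun n i => r n i * p n s)).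
    apply: (@is_derive_sum_seq _ _ (index_iota n0 m.+1)) => n.
    by rewrite mem_index_iota => /andP[nn0 _]; exact: fwd.
  by move=> n i nn0; rewrite r0 ?mul0r.
have dPhi (s : R) : 0 < s -> is_derive s 1 Phi (\sum_(n0 <= m < M) a m * dS m s).
  move=> s0; apply: is_derive_sum_seq => m _.
  exact: (@is_deriveZ _ _ _ (S m) (a m) s 1 _ (dS_ m s s0)).
have dPhi_ge (s : R) : 0 < s -> - C <= \sum_(n0 <= m < M) a m * dS m s.
  move=> s0; rewrite lerNl -sumrN.
  apply: le_trans (@sum_levels_le R k n0 M (p^~ s) _ (p1 M s (ltW s0))) => //.
  rewrite big_nat [leRHS]big_nat; apply: ler_sum => m /andP[n0m _].
  rewrite /dS mulrN opprK mulr_sumr.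
  rewrite big_nat [leRHS]big_nat; apply: ler_sum => n /andP[n0n nm].
  rewrite mulr_sumr.
  rewrite big_nat_cond [leRHS]big_nat_cond; apply: ler_sum => i /andP[ik mni].
  by rewrite mulrA ler_piMl// ar// ?n0n//.
have key h : 0 < h < t -> p n0 h * (\sum_(n0 <= m < M) a m) <= Phi t + C * t.
  move=> /andP[h0 ht].
  have itv0 x : x \in `[h, t] -> 0 < x.
    by rewrite in_itv/= => /andP[hx _]; exact: lt_le_trans hx.
  have [||c cht] := @MVT_segment R Phi
      (fun s => \sum_(n0 <= m < M) a m * dS m s) h t (ltW ht).
  - by move=> x xht; apply/dPhi/itv0; apply: subset_itv_oo_cc xht.
  - by apply: derivable_within_continuous => x /itv0/dPhi[].
  move=> E.
  have S_ge : p n0 h * (\sum_(n0 <= m < M) a m) <= Phi h.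
    rewrite mulr_sumr /Phi big_nat [leRHS]big_nat; apply: ler_sum => m /andP[n0m _].
    rewrite mulrC ler_wpM2l ?a0// /S big_ltn ?ltnS// lerDl.
    by rewrite sumr_ge0.
  have : - C * (t - h) <= Phi t - Phi h.
    by rewrite E ler_wpM2r ?subr_ge0 ?(ltW ht)// dPhi_ge// itv0.
  have : 0 <= C * h by rewrite mulr_ge0 ?(ltW h0)// sumr_ge0.
  by rewrite mulrBr; lra.
have : 1 * (\sum_(n0 <= m < M) a m) <= Phi t + C * t.
  apply: (@cvgr_to_le _ (0 : R)^'+ _ _ (fun h => p n0 h * _)).
    exact: cvgMr_tmp init.
  near=> h; apply: key; apply/andP; split; near: h.
    exact: nbhs_right_gt.
  exact: nbhs_right_lt.
rewrite mul1r -lerBlDl; apply: le_trans.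
rewrite /Phi -sumrB; apply: ler_sum => m _.
by rewrite mulrBr mulr1.
Unshelve. all: by end_near. Qed.

(** * State probabilities of the process *)

Section ProcessFacts.
Context {R : realType} {d : measure_display} {T : measurableType d}
  {P : probability T R} {k n0 : nat} {lam : nat -> nat -> R}
  {X : R -> T -> option nat}.
Hypothesis hX : generalized_birth_process P k n0 lam X.

Let measurable_at_state n t : 0 <= t -> measurable (at_state X n t).
Proof. by move=> t0; exact: (gbp_measurable hX [set Some n] t0). Qed.

Lemma state_prob_ge0 n t : 0 <= state_prob P X n t.
Proof. exact/fine_ge0. Qed.

Lemma EFin_state_prob n t : 0 <= t -> (state_prob P X n t)%:E = P (at_state X n t).
Proof.
by move=> t0; rewrite /state_prob fineK// fin_num_measure//; exact: measurable_at_state.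
Qed.

Lemma sum_state_prob_le1 N t : 0 <= t ->
  \sum_(n0 <= n < N) state_prob P X n t <= 1.
Proof.
move=> t0; apply: (@le_trans _ _ (\sum_(0 <= n < N) state_prob P X n t)).
  rewrite (big_nat_widenl n0 0)//= big_mkcond; apply: ler_sum => n _.
  by case: ifP => // _; exact: state_prob_ge0.
have mA n : measurable (at_state X n t) by exact: measurable_at_state.
rewrite -lee_fin -sumEFin big_mkord.
rewrite (eq_bigr (fun n : 'I_N => P (at_state X n t))); last first.
  by move=> n _; rewrite EFin_state_prob.
rewrite -(@measure_bigsetU _ _ _ P (fun n => at_state X n t))//.
  by apply: probability_le1; exact: bigsetU_measurable.
apply/trivIsetP => i j _ _ /eqP ij; rewrite -subset0 => w [].
by rewrite /at_state/= => -> [/ij].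
Qed.

Lemma state_prob_init : state_prob P X n0 0 = 1.
Proof. by rewrite /state_prob (gbp_init hX). Qed.

(** Right continuity at 0 of the probability of the initial state: the
    conditional probability of staying tends to 1 and, the condition having
    probability 1, bounds the state probability from below. *)
Lemma state_prob_cvg_init : state_prob P X n0 h @[h --> 0^'+] --> (1 : R).
Proof.
set L := \sum_(1 <= i < k.+1) lam n0 i.
pose f h := cond_prob P (at_state X n0 (0 + h)) (at_state X n0 0).
have f1 : f h @[h --> 0^'+] --> (1 : R).
  have := @gbp_stay _ _ _ _ _ _ _ _ hX n0 0 (leqnn _) (lexx _).
  rewrite state_prob_init => /(_ ltr01)/eqoP fo.
  have id0 : h @[h --> (0:R)^'+] --> (0 : R).
    exact: cvg_at_right_filter.
  have g0 : f h - (1 - L * h) @[h --> 0^'+] --> (0 : R).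
    apply/cvgr0Pnorm_le => e e0.
    near=> h.
    have h0 : 0 < h by near: h; exact: nbhs_right_gt.
    have h1 : h < e by near: h; exact: nbhs_right_lt.
    apply: (@le_trans _ _ (1 * `|h|)); first by near: h; exact: fo.
    by rewrite mul1r gtr0_norm// ltW.
  have -> : (1 : R) = 0 + (1 - L * 0) by rewrite mulr0 add0r subr0.
  rewrite (_ : f = fun h => (f h - (1 - L * h)) + (1 - L * h)).
    apply: cvgD g0 _; apply: cvgB; first exact: cvg_cst.
    exact: cvgMl_tmp id0.
  by apply/funext => h; rewrite subrK.
apply: (squeeze_cvgr (f := f) (h := cst 1)); [|exact: f1|exact: cvg_cst].
near=> h.
have h0 : 0 <= h by near: h; exact: nbhs_right_ge.
apply/andP; split; last first.
  by rewrite -lee_fin EFin_state_prob// probability_le1//; exact: measurable_at_state.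
rewrite /f /cond_prob (gbp_init hX) divr1 add0r /state_prob fine_le ?fin_num_measure//.
- by apply: measurableI; exact: measurable_at_state.
- exact: measurable_at_state.
- apply: le_measure; rewrite ?inE//.
  + by apply: measurableI; exact: measurable_at_state.
  + exact: measurable_at_state.
Unshelve. all: by end_near. Qed.
End ProcessFacts.

(** * Honesty of the process *)

Theorem theorem2p1 (R : realType) (d : measure_display) (T : measurableType d)
    (P : probability T R) (k n0 : nat) (lam : nat -> nat -> R)
    (X : R -> T -> option nat)
    (hk : (1 <= k)%N)
    (hlam : forall n i : nat, (n0 <= n)%N -> (1 <= i <= k)%N -> 0 < lam n i)
    (hX : generalized_birth_process P k n0 lam X)
    (hdiv : (\sum_(n0 <= m <oo)
       ((\sum_(1 <= i < k.+1) \sum_(1 <= j < i.+1)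
           rate n0 lam (m%:Z - j%:Z + 1) i ^+ 2) `^ (- 2^-1))%:E)%E
       = +oo%E) :
  forall t : R, 0 <= t ->
    (\sum_(n0 <= m <oo) (state_prob P X m t)%:E)%E = 1%E.
Proof.
move=> t t0.
set a := (X in (\sum_(n0 <= m <oo) (X m)%:E)%E = _) in hdiv.
set p := state_prob P X.
have p0 n s : 0 <= p n s by exact: state_prob_ge0.
have p1 N s : 0 <= s -> \sum_(n0 <= n < N) p n s <= 1.
  exact: (sum_state_prob_le1 hX).
have partial_le N : ((\sum_(n0 <= n < N) p n t)%:E <=
    \sum_(n0 <= m <oo) (p m t)%:E)%E.
  by rewrite -sumEFin; apply: nneseries_lim_ge => n _ _; rewrite lee_fin.
have total_le1 : (\sum_(n0 <= m <oo) (p m t)%:E <= 1)%E.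
  apply: lime_le; first by apply: is_cvg_nneseries => n _ _; rewrite lee_fin.
  by apply: nearW => N; rewrite sumEFin lee_fin p1.
apply/eqP; rewrite eq_le total_le1/=.
move: t0; rewrite (le_eqVlt 0 t) => /predU1P[t0|t0].
  apply: le_trans (partial_le n0.+1).
  by rewrite -t0 big_nat1 /p (state_prob_init hX).
rewrite leNgt; apply/negP => total_lt1.
have total_fin : (\sum_(n0 <= m <oo) (p m t)%:E)%E \is a fin_num.
  rewrite ge0_fin_numE; first exact: le_lt_trans total_le1 (ltry 1).
  by apply: nneseries_ge0 => n _ _; rewrite lee_fin.
set tot := fine (\sum_(n0 <= m <oo) (p m t)%:E)%E.
have tot_lt1 : 0 < 1 - tot by rewrite subr_gt0 -lte_fin fineK.
have partial_tot N : \sum_(n0 <= n < N) p n t <= tot by rewrite -lee_fin fineK.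
set B := (\sum_(1 <= i < k.+1) i%:R) * t.
have a_ge0 m : 0 <= a m by exact: powR_ge0.
have sum_a_le M : \sum_(n0 <= m < M) a m <= B / (1 - tot).
  rewrite ler_pdivlMr// mulr_suml.
  apply: (@le_trans _ _
    (\sum_(n0 <= m < M) a m * (1 - \sum_(n0 <= n < m.+1) p n t))).
    by apply: ler_sum => m _; rewrite ler_wpM2l// lerB.
  apply: (@weighted_deficit_le R k n0 M (fun n i => rate n0 lam n%:Z i) p a t) => //.
  - by move=> n i nn0; rewrite /rate lez_nat leqNgt nn0.
  - exact: (state_prob_cvg_init hX).
  - move=> n s n0n s0; have := gbp_forward hX n0n s0.
    rewrite mulNr mulr_suml.
    congr (is_derive _ _ _ (_ + _)).
    rewrite big_nat [RHS]big_nat; apply: eq_bigr => i /andP[_].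
    by rewrite ltnS leq_min => /andP[i_n _]; rewrite -subzn.
  - move=> m n i /andP[n0n nm] mni /andP[i1 ik].
    apply: powRVhalf_le.
      by rewrite /rate lez_nat n0n hlam// i1.
    (* the square of this rate is the (i, j)-term for j = m + 1 - n *)
    have -> : n%:Z = m%:Z - (m.+1 - n)%:Z + 1 by lia.
    rewrite (bigD1_seq i)/= ?mem_index_iota ?iota_uniq ?ltnS ?i1//.
    rewrite (bigD1_seq (m.+1 - n)%N)/= ?mem_index_iota ?iota_uniq//; last by lia.
    rewrite -[leRHS]addrA lerDl addr_ge0// sumr_ge0// => ? _; rewrite ?sqr_ge0//.
    by rewrite sumr_ge0// => ? _; rewrite sqr_ge0.
have : (\sum_(n0 <= m <oo) (a m)%:E <= (B / (1 - tot))%:E)%E.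
  apply: lime_le; first by apply: is_cvg_nneseries => m _ _; rewrite lee_fin.
  by apply: nearW => M; rewrite sumEFin lee_fin.
by rewrite hdiv leNgt ltry.
Qed.
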